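(* For any Hamiltonian linear hyperkähler action of the circle group $K=U(1)$ on a quaternionic vector space $V=\mathbb H^n$, with complex moment map $\mu_{\mathbb C}$, the function $-\|\mu_{\mathbb C}\|^2:V\to\mathbb R$ is flow-closed.
   Context: $V=\mathbb H^n=T^*\mathbb C^n$ carries its flat metric $g$ and complex structures $\mathbf i,\mathbf j,\mathbf k$ with $\mathbf i\mathbf j=\mathbf k=-\mathbf j\mathbf i$; symplectic forms $\omega_1,\omega_2,\omega_3$ are defined by $\omega_I(-,-)=g(-,I-)$ for $I=\mathbf i,\mathbf j,\mathbf k$. A linear hyperkähler action of $K$ (Lie algebra $\mathfrak k$) is a linear action preserving $g,\mathbf i,\mathbf j,\mathbf k$. It is Hamiltonian, with moment map a differentiable $K$-equivariant map $\mu=(\mu_1,\mu_2,\mu_3):V\to\mathfrak k^*\otimes_{\mathbb R}\mathbb R^3$ satisfying $\langle d\mu_l(v),\xi\rangle=\omega_l(\xi_m,v)$ for $m\in V$, $v\in T_mV$, $\xi\in\mathfrak k$, $l=1,2,3$, where $\xi_m$ is the value at $m$ of the vector field generated by $\xi$; it is determined up to adding central constants, and any such choice is allowed. $\mu_{\mathbb C}=\mu_2+\sqrt{-1}\mu_3$. Norms come from a fixed $K$-invariant inner product on $\mathfrak k$. A smooth function $h$ on a manifold is flow-closed if its gradient flow (forward in time) from any point is contained in a compact set. *)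

(* Defs.v *)
From HB Require Import structures.
From mathcomp Require Import all_boot all_order all_algebra.
From mathcomp Require Import complex.
From mathcomp Require Import all_classical all_reals all_analysis.

Set Implicit Arguments.
Unset Strict Implicit.
Unset Printing Implicit Defensive.

Import Order.TTheory GRing.Theory Num.Theory.
Import numFieldNormedType.Exports.

Local Open Scope classical_set_scope.
Local Open Scope complex_scope.
Local Open Scope ring_scope.

(* Row r of x : quat_space R n is the quaternion a + b i + c j + d k with
   coordinates (a, b, c, d) = (x r 0, x r 1, x r 2, x r 3). *)
Notation quat_space R n := 'M[R]_(n, 4).

Definition quat (R : realType) (a b c d : R) : 'rV[R]_4 :=
  \row_(l < 4) nth 0 [:: a; b; c; d] l.

(* The complex structures are left multiplication by i, j, k on each
   coordinate. *)
Definition Ii (R : realType) (n : nat) (x : quat_space R n) : quat_space R n :=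
  \matrix_(r < n) quat (- x r 1) (x r 0) (- x r 3) (x r 2).

Definition Ij (R : realType) (n : nat) (x : quat_space R n) : quat_space R n :=
  \matrix_(r < n) quat (- x r 2) (x r 3) (x r 0) (- x r 1).

Definition Ik (R : realType) (n : nat) (x : quat_space R n) : quat_space R n :=
  \matrix_(r < n) quat (- x r 3) (- x r 2) (x r 1) (x r 0).

Lemma quaternion_relations (R : realType) (n : nat) (x : quat_space R n) :
  [/\ Ii (Ii x) = - x, Ij (Ij x) = - x, Ii (Ij x) = Ik x
    & Ij (Ii x) = - Ik x].
Proof.
by split; apply/matrixP => r l; rewrite !mxE; case: l => [[|[|[|[|//]]]] ?];
  rewrite /= ?mxE /= ?opprK; (congr (- x _ _) || congr (x _ _)); apply/val_inj.
Qed.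

Definition flat_metric (R : realType) (n : nat) (x y : quat_space R n) : R :=
  \sum_(r < n) \sum_(l < 4) x r l * y r l.

Definition omega (R : realType) (n : nat)
    (I : quat_space R n -> quat_space R n) (x y : quat_space R n) : R :=
  flat_metric x (I y).

Definition U1 (R : realType) : set R[i] := [set z | `|z| = 1].

(* The Lie algebra of U(1), namely sqrt(-1) R, is identified with R: the
   exponential map is xi |-> expi xi.  Its dual is identified with R too, alpha
   being the functional xi |-> alpha * xi.  As U(1) is abelian, its adjoint and
   coadjoint actions are trivial. *)
Definition expi (R : realType) (t : R) : R[i] := cos t +i* sin t.

(* Only the values act z with z \in U(1) matter.  Smoothness of the action is
   expressed in the coordinate expi of U(1); as act z is linear in its second
   argument, it need only be required in the first one. *)
Record linear_hyperkahler_action (R : realType) (n : nat)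
    (act : R[i] -> quat_space R n -> quat_space R n) : Prop := {
  act_one : forall x, act 1 x = x;
  act_mul : forall z w x, U1 z -> U1 w -> act (z * w) x = act z (act w x);
  act_linear : forall z a x y, U1 z ->
    act z (a *: x + y) = a *: act z x + act z y;
  act_smooth : forall x k t,
    derivable (derive1n k (fun s => act (expi s) x)) t 1;
  act_metric : forall z x y, U1 z ->
    flat_metric (act z x) (act z y) = flat_metric x y;
  act_i : forall z x, U1 z -> act z (Ii x) = Ii (act z x);
  act_j : forall z x, U1 z -> act z (Ij x) = Ij (act z x);
  act_k : forall z x, U1 z -> act z (Ik x) = Ik (act z x)
}.

Definition generated_field (R : realType) (n : nat)
    (act : R[i] -> quat_space R n -> quat_space R n) (xi : R)
    (m : quat_space R n) : quat_space R n :=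
  derive1 (fun t : R => act (expi (t * xi)) m) 0.

Definition is_moment_component (R : realType) (n : nat)
    (act : R[i] -> quat_space R n -> quat_space R n)
    (I : quat_space R n -> quat_space R n) (mu : quat_space R n -> R) : Prop :=
  [/\ forall m, differentiable mu m,
      forall z m, U1 z -> mu (act z m) = mu m
    & forall m v xi,
        'd mu m v * xi = omega I (generated_field act xi m) v].

Definition is_moment_map (R : realType) (n : nat)
    (act : R[i] -> quat_space R n -> quat_space R n)
    (mu1 mu2 mu3 : quat_space R n -> R) : Prop :=
  [/\ is_moment_component act (@Ii R n) mu1,
      is_moment_component act (@Ij R n) mu2
    & is_moment_component act (@Ik R n) mu3].

Definition complex_moment_map (R : realType) (n : nat)
    (mu2 mu3 : quat_space R n -> R) (m : quat_space R n) : R[i] :=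
  mu2 m +i* mu3 m.

(* Invariance under the (trivial) adjoint action is automatic. *)
Record lie_inner_product (R : realType) (B : R -> R -> R) : Prop := {
  lie_inner_linear : forall a x y z, B (a * x + y) z = a * B x z + B y z;
  lie_inner_sym : forall x y, B x y = B y x;
  lie_inner_pos : forall x, x != 0 -> 0 < B x x
}.

(* The element of the Lie algebra representing the functional alpha. *)
Definition sharp (R : realType) (B : R -> R -> R) (alpha : R) : R :=
  alpha / B 1 1.

Lemma sharpP (R : realType) (B : R -> R -> R) (alpha xi : R) :
  lie_inner_product B -> B (sharp B alpha) xi = alpha * xi.
Proof.
move=> hB.
have B0l y : B 0 y = 0.
  by have /eqP := lie_inner_linear hB 1 0 0 y;
    rewrite mulr0 addr0 mul1r -subr_eq0 opprD addNKr oppr_eq0 => /eqP.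
have Bl a y : B a y = a * B 1 y.
  by have := lie_inner_linear hB a 1 0 y; rewrite mulr1 !addr0 B0l addr0.
have B11 : B 1 1 != 0 by rewrite gt_eqF // (lie_inner_pos hB) // oner_neq0.
rewrite Bl (lie_inner_sym hB) (Bl xi) /sharp.
by rewrite [xi * _]mulrC mulrA divfK.
Qed.

(* The squared norm on the complexified dual of the Lie algebra induced by the
   inner product B. *)
Definition dual_normsq (R : realType) (B : R -> R -> R) (alpha : R[i]) : R :=
  B (sharp B (complex.Re alpha)) (sharp B (complex.Re alpha)) +
  B (sharp B (complex.Im alpha)) (sharp B (complex.Im alpha)).

(* gam is an integral curve, on [0, T[ with T possibly +oo, of the gradient of
   h for the flat metric, starting at p.  At time 0 only continuity is required,
   since gam t is irrelevant for t < 0. *)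
Definition gradient_trajectory (R : realType) (n : nat)
    (h : quat_space R n -> R) (p : quat_space R n) (T : \bar R)
    (gam : R -> quat_space R n) : Prop :=
  [/\ gam 0 = p,
      {within [set t | 0 <= t /\ (t%:E < T)%E], continuous gam}
    & forall t, 0 < t -> (t%:E < T)%E ->
        derivable gam t 1 /\
        forall v, flat_metric (derive1 gam t) v = 'd h (gam t) v].

(* T ranges over all existence times, in particular over the maximal one. *)
Definition flow_closed (R : realType) (n : nat) (h : quat_space R n -> R) :
    Prop :=
  forall p, exists2 C : set (quat_space R n), compact C &
    forall (T : \bar R) (gam : R -> quat_space R n),
      gradient_trajectory h p T gam ->
      forall t, 0 <= t -> (t%:E < T)%E -> C (gam t).

(* Main.v *)
Require Import Defs.
From HB Require Import structures.
From mathcomp Require Import all_boot all_order all_algebra.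
From mathcomp Require Import complex.
From mathcomp Require Import all_classical all_reals all_analysis.
From mathcomp Require Import ring lra.
Import Order.TTheory GRing.Theory Num.Theory.
Import numFieldNormedType.Exports.
Local Open Scope complex_scope.
Local Open Scope ring_scope.

(** Let A be the infinitesimal generator of the action: a linear map, skew for
the flat metric g and commuting with j and k.  By the moment map equation
grad mu2 = - j A m and grad mu3 = - k A m, so with c = 1 / B 1 1 a trajectory of
the function of the theorem satisfies
    gam' = 2 c (mu2 j X + mu3 k X),    X = A gam.
Boundedness comes from two features of this equation.

(1) X stays bounded.  As j X and k X are orthogonal of the same length as X, both
components of the complex moment map solve the same scalar equation
    mu2' = - 2 c |X|^2 mu2,    mu3' = - 2 c |X|^2 mu3,
so that each keeps its sign and decreases in absolute value.  On the other hand
|X|^2 grows at a rate that is at most a multiple of (|mu2| + |mu3|) |X|^2, since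
x |-> g(x, A j x) and x |-> g(x, A k x) are quadratic forms, and this is the rate
at which |mu2| + |mu3| decreases, up to a factor.  So
    |X|^2 + K (|mu2| + |mu3|)
is nonincreasing for a suitable constant K (growth_le_decay_bounded).

(2) The velocity lies in the image of A, as j and k commute with A.  Since A is
skew, A is injective on its image, so there is a linear P inverting it there,
that is with P A A = A (linear_factor).  Then gam - P A gam is constant, and
gam = gam(0) - P A gam(0) + P X lies in the image of a closed box under a
continuous map; this image is compact and depends only on gam(0). *)

(** * Linear maps between spaces of matrices *)
(** A linear map factors through f as soon as it kills the kernel of f: on the
    image of f, the pseudo-inverse of f picks some preimage, and the choice of
    that preimage does not matter. *)
Lemma linear_factor (F : fieldType) (m n p q : nat)
    (f : {linear 'M[F]_(m, n) -> 'M[F]_(m, n)})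
    (g : {linear 'M[F]_(m, n) -> 'M[F]_(p, q)}) :
  (forall x, f x = 0 -> g x = 0) ->
  exists P : {linear 'M[F]_(m, n) -> 'M[F]_(p, q)}, forall x, P (f x) = g x.
Proof.
move=> fg; pose L := lin_mx f.
exists (vec_mx \o mulmxr (pinvmx L *m lin_mx g) \o mxvec) => x /=.
(* x' is the preimage of f x chosen by the pseudo-inverse. *)
pose x' := vec_mx (mxvec x *m L *m pinvmx L).
have fx' : f (x - x') = 0.
  rewrite linearB /= -[X in _ - X]mx_vec_lin vec_mxK.
  by rewrite mulmxKpV ?submxMl // mul_vec_lin mxvecK subrr.
have /eqP := fg _ fx'; rewrite linearB subr_eq0 => /eqP ->.
by rewrite -[RHS]mx_vec_lin vec_mxK -mul_vec_lin !mulmxA.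
Qed.

Section MatrixLinear.
Variables (R : realType) (m n : nat).

Lemma mx_linear_continuous (W : normedModType R)
  (f : {linear 'M[R]_(m, n) -> W}) : continuous f.
Proof.
have -> : (f : _ -> _) =
    (fun x => \sum_i \sum_j (x i j *: f (delta_mx i j))).
  apply/funext => x; rewrite {1}[x]matrix_sum_delta linear_sum.
  apply: eq_bigr => i _; rewrite linear_sum; apply: eq_bigr => j _.
  by rewrite linearZ.
apply: continuous_big => [|i _]; first exact: add_continuous.
apply: continuous_big => [|j _ x]; first exact: add_continuous.
apply: (@cvgZr_tmp _ _ _ (nbhs x) _ (fun y => y i j)); exact: coord_continuous.
Qed.

End MatrixLinear.

Section MatrixCalculus.
Variables (R : realType) (m n : nat).

Lemma is_derive_diff_comp (W : normedModType R)
    (f : 'M[R]_(m, n) -> W) (F : R -> 'M[R]_(m, n)) (t : R) v :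
  differentiable f (F t) -> is_derive t 1 F v ->
  is_derive t 1 (f \o F) ('d f (F t) v).
Proof.
move=> df [dF <-]; have /derivable1_diffP dF' := dF.
have dfF : differentiable (f \o F) t by exact: differentiable_comp.
split; first exact/derivable1_diffP.
by rewrite deriveE // diff_comp // [in RHS]deriveE.
Qed.

Lemma is_derive_linear (W : normedModType R)
    (f : {linear 'M[R]_(m, n) -> W}) (F : R -> 'M[R]_(m, n)) (t : R) v :
  is_derive t 1 F v -> is_derive t 1 (f \o F) (f v).
Proof.
have cf : continuous f by exact: mx_linear_continuous.
have <- : 'd f (F t) v = f v by rewrite diff_lin.
by apply: is_derive_diff_comp; exact: linear_differentiable.
Qed.

Lemma is_derive_coord (F : R -> 'M[R]_(m, n)) (t : R) v i j :
  is_derive t 1 F v -> is_derive t 1 (fun s => F s i j) (v i j).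
Proof.
move=> [dF <-]; split; first exact: (derivable_mxP F t 1).1.
by rewrite derive_mx // mxE.
Qed.

Lemma mx_box_compact (r : R) :
  compact [set x : 'M[R]_(m, n) | forall i j, `|x i j| <= r]%classic.
Proof.
pose box := [set v : 'rV[R]_(m * n) | forall k, `[(- r), r]%classic (v ord0 k)]%classic.
have cbox : compact box.
  apply: (@rV_compact _ _ (fun=> `[(- r), r]%classic)).
  by move=> _; apply: segment_compact.
have -> : [set x : 'M[R]_(m, n) | forall i j, `|x i j| <= r]%classic =
    (vec_mx @` box)%classic.
  apply/seteqP; split => [x xr|_ [v vr <-] i j] /=; last first.
    by have := vr (mxvec_index i j); rewrite /= in_itv /= -ler_norml mxE.
  exists (mxvec x); last exact: mxvecK.
  move=> k; case/mxvec_indexP: k => i j.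
  by rewrite /= in_itv /= -ler_norml mxvecE.
apply: continuous_compact => //; apply: continuous_subspaceT.
exact: mx_linear_continuous.
Qed.

End MatrixCalculus.

(** * The flat metric and the quaternionic structure *)
Section FlatMetric.
Variables (R : realType) (n : nat).
Implicit Types x y z : quat_space R n.

Lemma flat_metricDl x y z :
  flat_metric (x + y) z = flat_metric x z + flat_metric y z.
Proof.
rewrite /flat_metric -big_split; apply: eq_bigr => r _ /=.
by rewrite -big_split; apply: eq_bigr => l _ /=; rewrite !mxE mulrDl.
Qed.

Lemma flat_metricZl a x y : flat_metric (a *: x) y = a * flat_metric x y.
Proof.
rewrite /flat_metric mulr_sumr; apply: eq_bigr => r _ /=.
by rewrite mulr_sumr; apply: eq_bigr => l _ /=; rewrite !mxE mulrA.
Qed.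

Lemma flat_metricC x y : flat_metric x y = flat_metric y x.
Proof. by apply: eq_bigr => r _; apply: eq_bigr => l _; rewrite mulrC. Qed.

Lemma flat_metricDr x y z :
  flat_metric x (y + z) = flat_metric x y + flat_metric x z.
Proof. by rewrite flat_metricC flat_metricDl !(flat_metricC x). Qed.

Lemma flat_metricZr a x y : flat_metric x (a *: y) = a * flat_metric x y.
Proof. by rewrite flat_metricC flat_metricZl flat_metricC. Qed.

Lemma flat_metricr0 x : flat_metric x 0 = 0.
Proof. by rewrite -(scale0r 0) flat_metricZr mul0r. Qed.

Lemma coord_sqr_le_flat_metric x r l : x r l ^+ 2 <= flat_metric x x.
Proof.
rewrite /flat_metric (bigD1 r) //= (bigD1 l) //= -expr2 -addrA lerDl.
by rewrite addr_ge0 ?sumr_ge0 // => i _; rewrite ?sumr_ge0 // => *;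
  rewrite -expr2 sqr_ge0.
Qed.

Lemma flat_metric_ge0 x : 0 <= flat_metric x x.
Proof.
by apply: sumr_ge0 => r _; apply: sumr_ge0 => l _; rewrite -expr2 sqr_ge0.
Qed.

Lemma flat_metric_eq0 x : flat_metric x x = 0 -> x = 0.
Proof.
move=> x0; apply/matrixP => r l; rewrite mxE; apply/eqP.
by rewrite -sqrf_eq0 eq_le sqr_ge0 andbT -x0 coord_sqr_le_flat_metric.
Qed.

Lemma flat_metric_inj x y :
  (forall v, flat_metric x v = flat_metric y v) -> x = y.
Proof.
move=> xy; apply/eqP; rewrite -subr_eq0; apply/eqP/flat_metric_eq0.
by rewrite -{1}(scaleN1r y) flat_metricDl flat_metricZl xy mulN1r subrr.
Qed.

(** The norm on matrices is the maximum of the absolute values of the entries, so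
    its square is one of the squares that the flat metric sums. *)
Lemma sqr_norm_le_flat_metric x : `|x| ^+ 2 <= flat_metric x x.
Proof.
have [->|x0] := eqVneq x 0; first by rewrite normr0 expr0n flat_metric_ge0.
have [[r l] ->] : exists i, `|x| = `|x i.1 i.2|.
  by apply: (@mx_norm_neq0 R n 4 x); move: x0; rewrite -normr_eq0.
by rewrite real_normK ?num_real // coord_sqr_le_flat_metric.
Qed.

Lemma quadratic_form_bounded (T : {linear quat_space R n -> quat_space R n}) :
  exists2 K, 0 <= K & forall x, `|flat_metric x (T x)| <= K * flat_metric x x.
Proof.
have /linear_bounded_continuous/linear_boundedP/pinfty_ex_gt0 :
  continuous T by exact: mx_linear_continuous.
move=> [k k0 Tk].
have coord_le (y : quat_space R n) r l : `|y r l| <= `|y|.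
  rewrite [leRHS]/Num.Def.normr /= mx_normrE; apply: (le_bigmax _ _ (r, l)).
exists (\sum_(r < n) \sum_(l < 4) k).
  by do 2 (apply: sumr_ge0 => ? _); exact: ltW.
move=> x; rewrite mulr_suml; apply: le_trans (ler_norm_sum _ _ _) _.
apply: ler_sum => r _; rewrite mulr_suml.
apply: le_trans (ler_norm_sum _ _ _) _; apply: ler_sum => l _.
rewrite normrM; apply: (@le_trans _ _ (`|x| * (k * `|x|))).
  by apply: ler_pM => //; apply: le_trans (Tk x).
rewrite mulrCA -expr2; apply: ler_wpM2l; first exact: ltW.
exact: sqr_norm_le_flat_metric.
Qed.

Lemma is_derive_flat_metric (F G : R -> quat_space R n) (t : R) u v :
  is_derive t 1 F u -> is_derive t 1 G v ->
  is_derive t 1 (fun s => flat_metric (F s) (G s))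
    (flat_metric u (G t) + flat_metric (F t) v).
Proof.
move=> dF dG.
have -> : (fun s => flat_metric (F s) (G s)) =
    \sum_(r < n) \sum_(l < 4) ((fun s => F s r l) * (fun s => G s r l)).
  apply/funext => s; rewrite fct_sumE; apply: eq_bigr => r _.
  by rewrite fct_sumE.
rewrite /flat_metric -big_split /=.
apply: is_derive_sum => r; rewrite -big_split /=.
apply: is_derive_sum => l.
have dFc := is_derive_coord _ _ _ _ _ _ r l dF.
have dGc := is_derive_coord _ _ _ _ _ _ r l dG.
apply: is_derive_eq; rewrite /GRing.scale /=; ring.
Qed.

Lemma flat_metric_continuous (T : topologicalType) (f g : T -> quat_space R n) :
  continuous f -> continuous g ->
  continuous (fun p => flat_metric (f p) (g p)).
Proof.
move=> cf cg; apply: continuous_big => [|r _]; first exact: add_continuous.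
apply: continuous_big => [|l _ p]; first exact: add_continuous.
apply: cvgM.
- exact: (continuous_comp (cf p) (@coord_continuous _ _ _ r l (f p))).
- exact: (continuous_comp (cg p) (@coord_continuous _ _ _ r l (g p))).
Qed.

Lemma flat_metric_coords x y : flat_metric x y =
  \sum_(r < n) (x r 0 * y r 0 + x r 1 * y r 1 + x r 2 * y r 2 + x r 3 * y r 3).
Proof.
apply: eq_bigr => r _; rewrite !big_ord_recl big_ord0 addr0 !addrA.
by congr (_ + _ + _ + _); congr (x _ _ * y _ _); exact/val_inj.
Qed.

Lemma Ij_linear : linear (@Ij R n).
Proof.
move=> a x y; apply/matrixP => r [[|[|[|[|//]]]] lP];
  rewrite !mxE /= ?mxE; ring.
Qed.
HB.instance Definition _ :=
  GRing.isLinear.Build R (quat_space R n) (quat_space R n) _ (@Ij R n) Ij_linear.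

Lemma Ik_linear : linear (@Ik R n).
Proof.
move=> a x y; apply/matrixP => r [[|[|[|[|//]]]] lP];
  rewrite !mxE /= ?mxE; ring.
Qed.
HB.instance Definition _ :=
  GRing.isLinear.Build R (quat_space R n) (quat_space R n) _ (@Ik R n) Ik_linear.

Lemma Ij_skew x y : flat_metric x (Ij y) = - flat_metric (Ij x) y.
Proof.
rewrite !flat_metric_coords -sumrN; apply: eq_bigr => r _; rewrite !mxE /=; ring.
Qed.

Lemma Ik_skew x y : flat_metric x (Ik y) = - flat_metric (Ik x) y.
Proof.
rewrite !flat_metric_coords -sumrN; apply: eq_bigr => r _; rewrite !mxE /=; ring.
Qed.

Lemma Ij_isometry x : flat_metric (Ij x) (Ij x) = flat_metric x x.
Proof.
rewrite !flat_metric_coords; apply: eq_bigr => r _; rewrite !mxE /=; ring.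
Qed.

Lemma Ik_isometry x : flat_metric (Ik x) (Ik x) = flat_metric x x.
Proof.
rewrite !flat_metric_coords; apply: eq_bigr => r _; rewrite !mxE /=; ring.
Qed.

Lemma Ij_Ik_orthogonal x : flat_metric (Ij x) (Ik x) = 0.
Proof.
by rewrite flat_metric_coords big1 // => r _; rewrite !mxE /=; ring.
Qed.

End FlatMetric.

(** * The infinitesimal action *)
Section Infinitesimal.
Variables (R : realType) (n : nat).
Variable act : R[i] -> quat_space R n -> quat_space R n.
Hypothesis hact : linear_hyperkahler_action act.

Lemma U1_expi t : U1 (expi t : R[i]).
Proof.
by rewrite /U1 /= /expi normc_def /= cos2Dsin2 sqrtr1.
Qed.

Lemma is_derive_generated_field x :
  is_derive (0 : R) 1 (fun t => act (expi t) x) (generated_field act 1 x).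
Proof.
have := @act_smooth R n act hact x 0 0; rewrite derive1n0 => dx.
split; first exact: dx.
rewrite /generated_field derive1E.
have -> // : (fun t : R => act (expi (t * 1)) x) = (fun t => act (expi t) x).
by apply/funext => t; rewrite mulr1.
Qed.

Lemma generated_field_linear : linear (generated_field act 1).
Proof.
move=> a x y.
have dx := is_derive_generated_field x.
have dy := is_derive_generated_field y.
have dxy := is_derive_generated_field (a *: x + y).
rewrite -(@derive_val _ _ _ _ _ _ _ dxy).
have -> : (fun t => act (expi t) (a *: x + y)) =
    (a \*: (fun t => act (expi t) x)) + (fun t => act (expi t) y).
  by apply/funext => t; rewrite (act_linear hact) //; exact: U1_expi.
have dS := is_deriveD (is_deriveZ a dx) dy.
exact: (@derive_val _ _ _ _ _ _ _ dS).
Qed.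

Lemma generated_field_comm (J : {linear quat_space R n -> quat_space R n}) :
  (forall z x, U1 z -> act z (J x) = J (act z x)) ->
  forall x, generated_field act 1 (J x) = J (generated_field act 1 x).
Proof.
move=> actJ x.
have dJx := is_derive_generated_field (J x).
rewrite -(@derive_val _ _ _ _ _ _ _ dJx).
have -> : (fun t => act (expi t) (J x)) = J \o (fun t => act (expi t) x).
  by apply/funext => t; rewrite actJ //; exact: U1_expi.
have := is_derive_linear _ _ _ _ J _ _ _ (is_derive_generated_field x).
by move=> /(@derive_val _ _ _ _ _ _ _).
Qed.

(** The derivative at 0 of the constant function t |-> g(e^it x, e^it y). *)
Lemma generated_field_skew x y :
  flat_metric (generated_field act 1 x) y =
  - flat_metric x (generated_field act 1 y).
Proof.
have act0 z : act (expi 0) z = z.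
  by rewrite /expi cos0 sin0; exact: (act_one hact).
have := is_derive_flat_metric _ _ _ _ _ _ _
  (is_derive_generated_field x) (is_derive_generated_field y).
rewrite !act0.
have -> : (fun t => flat_metric (act (expi t) x) (act (expi t) y)) =
    cst (flat_metric x y).
  by apply/funext => t; rewrite (act_metric hact) //; exact: U1_expi.
move=> /(@derive_val _ _ _ _ _ _ _); rewrite derive_cst => /esym/eqP.
by rewrite addr_eq0 => /eqP.
Qed.

Lemma infinitesimal_action :
  exists A : {linear quat_space R n -> quat_space R n},
    [/\ forall x, generated_field act 1 x = A x,
        forall x y, flat_metric (A x) y = - flat_metric x (A y),
        forall x, A (Ij x) = Ij (A x) & forall x, A (Ik x) = Ik (A x)].
Proof.
pose mix := GRing.isLinear.Build _ _ _ _ _ generated_field_linear.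
pose A : {linear _ -> _} := HB.pack (generated_field act 1) mix.
exists A; split=> //; first exact: generated_field_skew.
- by apply: generated_field_comm; exact: (act_j hact).
- by apply: generated_field_comm; exact: (act_k hact).
Qed.

End Infinitesimal.

(** * Scalar differential inequalities *)
Section ScalarODE.
Local Open Scope classical_set_scope.
Local Open Scope ring_scope.
Variable R : realType.
Implicit Types (f g y z M : R -> R) (s t a b : R).

Lemma derive_le0_le f f' a b : a <= b ->
  {within `[a, b], continuous f} ->
  (forall s, a < s < b -> is_derive s 1 f (f' s)) ->
  (forall s, a < s < b -> f' s <= 0) -> f b <= f a.
Proof.
rewrite le_eqVlt => /predU1P[-> //|ab] cf df f'0.
have dfi s : s \in `]a, b[%R -> is_derive s 1 f (f' s) by rewrite in_itv => /df.
have [s sab fab] := MVT ab dfi cf.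
rewrite -subr_le0 fab; apply: mulr_le0_ge0; last by rewrite subr_ge0 ltW.
by apply: f'0; rewrite in_itv in sab.
Qed.

Definition decays (rate y : R -> R) t :=
  {within `[0, t], continuous y} /\
  forall s, 0 < s < t -> is_derive s 1 y (- rate s * y s).

Lemma within_itvW f a b a' b' : a <= a' -> b' <= b ->
  {within `[a, b], continuous f} ->
  {within `[a', b'], continuous f}.
Proof.
move=> aa bb; apply: continuous_subspaceW => s /=; rewrite !in_itv /=.
by move=> /andP[/(le_trans aa) -> /le_trans -> ].
Qed.

(** The square of y is nonincreasing, so y cannot leave 0 once it has reached
    it; by the intermediate value theorem it would have to do so in order to
    become negative. *)
Lemma decays_ge0 rate y t : 0 <= t -> (forall s, 0 <= rate s) ->
  decays rate y t -> 0 <= y 0 -> 0 <= y t.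
Proof.
move=> t0 rate0 [cy dy] y0; rewrite leNgt; apply/negP => yt.
have [|s] := IVT t0 cy (v := 0).
  by rewrite ge_min le_max y0 (ltW yt) orbT.
rewrite in_itv /= => /andP[s0 st] ys.
have : y t * y t <= y s * y s.
  apply: (@derive_le0_le (y * y) (fun r => (- rate r * (y r * y r)) *+ 2)) => //.
  - move=> r; apply: cvgM; exact: (@within_itvW y 0 t s t _ _ cy).
  - move=> r /andP[sr rt]; have dyr := dy r; rewrite (le_lt_trans s0 sr) rt in dyr.
    have {}dyr := dyr isT.
    by apply: is_derive_eq; rewrite /GRing.scale /=; ring.
  - move=> r _; rewrite pmulrn_lle0 // mulNr oppr_le0 mulr_ge0 //.
    by rewrite -expr2 sqr_ge0.
by rewrite ys mulr0 leNgt; nra.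
Qed.

Lemma decaysW rate y s t : s <= t -> decays rate y t -> decays rate y s.
Proof.
move=> st [cy dy]; split; first exact: within_itvW cy.
by move=> r /andP[r0 rs]; apply: dy; rewrite r0 (lt_le_trans rs).
Qed.

Lemma decaysN rate y t : decays rate y t -> decays rate (- y) t.
Proof.
move=> [cy dy]; split; first by move=> s; apply: cvgN; exact: cy.
move=> s /dy dys; apply: is_derive_eq.
by rewrite -mulrN.
Qed.

Lemma decays_abs rate y t : (forall s, 0 <= rate s) -> decays rate y t ->
  exists e, forall s, 0 <= s <= t -> `|y s| = e * y s.
Proof.
move=> rate0 dy; have [y0|y0] := leP 0 (y 0).
  exists 1 => s /andP[s0 st]; rewrite mul1r ger0_norm //.
  by apply: (decays_ge0 rate _ s) => //; exact: decaysW dy.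
exists (-1) => s /andP[s0 st]; rewrite mulN1r ler0_norm //.
rewrite -oppr_ge0; apply: (decays_ge0 rate (- y) s) => //.
  by apply/decaysN; exact: decaysW dy.
by rewrite oppr_ge0 ltW.
Qed.

(** As y and z have constant signs, their absolute values are differentiable,
    and what M can gain is bounded by what |y| + |z| loses: the combination
    M + K (|y| + |z|) has a nonpositive derivative. *)
Lemma growth_le_decay_bounded (k K : R) M M' y z t :
  0 <= k -> 0 <= K -> 0 <= t -> (forall s, 0 <= M s) ->
  decays (fun s => k * M s) y t -> decays (fun s => k * M s) z t ->
  {within `[0, t], continuous M} ->
  (forall s, 0 < s < t -> is_derive s 1 M (M' s)) ->
  (forall s, 0 < s < t -> M' s <= K * (k * M s) * (`|y s| + `|z s|)) ->
  M t <= M 0 + K * (`|y 0| + `|z 0|).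
Proof.
move=> k0 K0 t0 M0 dy dz cM dM M'le.
have rate0 s : 0 <= k * M s by rewrite mulr_ge0.
have [e ye] := decays_abs _ _ _ rate0 dy.
have [f zf] := decays_abs _ _ _ rate0 dz.
have [cy {}dy] := dy; have [cz {}dz] := dz.
pose phi := M + (K \*: ((e \*: y) + (f \*: z))) : R -> R.
have : phi t <= phi 0.
  apply: (@derive_le0_le _
    (fun s => M' s - K * (k * M s) * (`|y s| + `|z s|))) => //.
  - move=> s; apply: cvgD; first exact: cM.
    apply: cvgZl_tmp; apply: cvgD; apply: cvgZl_tmp; [exact: cy|exact: cz].
  - move=> s st; have dMs := dM s st; have dys := dy s st; have dzs := dz s st.
    apply: is_derive_eq; rewrite ye ?zf; last 2 first.
    + by case/andP: st => /ltW -> /ltW ->.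
    + by case/andP: st => /ltW -> /ltW ->.
    by rewrite /GRing.scale /=; ring.
  - by move=> s /M'le; rewrite subr_le0.
have -> : phi 0 = M 0 + K * (`|y 0| + `|z 0|).
  by rewrite ye ?zf ?lexx.
apply: le_trans.
have -> : phi t = M t + K * (`|y t| + `|z t|).
  by rewrite ye ?zf ?lexx ?t0.
by rewrite lerDl mulr_ge0 // addr_ge0.
Qed.

End ScalarODE.

(** * The gradient flow *)

(** The gradient of - c (mu2^2 + mu3^2) when A generates the action and mu2, mu3
    are moment maps for j, k; see gradient_moment_normsq. *)
Definition normsq_gradient (R : realType) (n : nat)
    (A : quat_space R n -> quat_space R n) (mu2 mu3 : quat_space R n -> R)
    (c : R) (m : quat_space R n) : quat_space R n :=
  (2 * c) *: (mu2 m *: Ij (A m) + mu3 m *: Ik (A m)).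

Section GradientFlow.
Local Open Scope classical_set_scope.
Local Open Scope ring_scope.
Variables (R : realType) (n : nat).
Local Notation V := (quat_space R n).
Variables (A : {linear V -> V}) (mu2 mu3 : V -> R) (c : R).
Hypothesis A_skew : forall x y, flat_metric (A x) y = - flat_metric x (A y).
Hypothesis A_Ij : forall x, A (Ij x) = Ij (A x).
Hypothesis A_Ik : forall x, A (Ik x) = Ik (A x).
Hypothesis mu2_diff : forall m, differentiable mu2 m.
Hypothesis mu3_diff : forall m, differentiable mu3 m.
Hypothesis d_mu2 : forall m v, 'd mu2 m v = flat_metric (A m) (Ij v).
Hypothesis d_mu3 : forall m v, 'd mu3 m v = flat_metric (A m) (Ik v).
Hypothesis c_ge0 : 0 <= c.

Local Notation grad := (normsq_gradient R n A mu2 mu3 c).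

Lemma gradient_moment_normsq (m v : V) :
  'd (fun p : V => - (c * (mu2 p ^+ 2 + mu3 p ^+ 2))) m v =
  flat_metric (grad m) v.
Proof.
set h := fun _ => _.
have hE : h = - (c \*: (mu2 ^+ 2 + mu3 ^+ 2)) by [].
have h_diff : differentiable h m.
  rewrite hE; apply: differentiableN; apply: differentiableZ.
  by apply: differentiableD; apply: differentiableX.
have d2 : is_derive m v mu2 (flat_metric (A m) (Ij v)).
  split; last by rewrite deriveE.
  exact: diff_derivable.
have d3 : is_derive m v mu3 (flat_metric (A m) (Ik v)).
  split; last by rewrite deriveE.
  exact: diff_derivable.
rewrite -deriveE // hE derive_val.
rewrite Ij_skew Ik_skew /normsq_gradient flat_metricZl flat_metricDl !flat_metricZl.
by rewrite /GRing.scale /=; ring.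
Qed.

Section Trajectory.
Variables (gam : R -> V) (t : R).
Hypothesis t_ge0 : 0 <= t.
Hypothesis gam_cont : {within `[0, t], continuous gam}.
Hypothesis gam_flow : forall s, 0 < s < t -> is_derive s 1 gam (grad (gam s)).

Let field_normsq s := flat_metric (A (gam s)) (A (gam s)).

Lemma continuous_along (W : topologicalType) (f : V -> W) :
  continuous f -> {within `[0, t], continuous (f \o gam)}.
Proof. by move=> cf; apply: within_continuous_comp => // x _; exact: cf. Qed.

Lemma is_derive_along (mu : V -> R) s : 0 < s < t ->
  (forall m, differentiable mu m) ->
  is_derive s 1 (mu \o gam) ('d mu (gam s) (grad (gam s))).
Proof. by move=> st dmu; apply: is_derive_diff_comp; last exact: gam_flow. Qed.

(** The velocity is - 2 c (mu2 grad mu2 + mu3 grad mu3), and the gradients of mu2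
    and mu3 are orthogonal, both of length |A gam|. *)
Lemma mu2_decays : decays R (fun s => (2 * c) * field_normsq s) (mu2 \o gam) t.
Proof.
split.
  by apply: continuous_along => m; exact: differentiable_continuous.
move=> s st; have ds := is_derive_along mu2 s st mu2_diff.
apply: is_derive_eq; rewrite d_mu2 Ij_skew /normsq_gradient flat_metricZr.
rewrite flat_metricDr !flat_metricZr Ij_isometry Ij_Ik_orthogonal /field_normsq /=; ring.
Qed.

Lemma mu3_decays : decays R (fun s => (2 * c) * field_normsq s) (mu3 \o gam) t.
Proof.
split.
  by apply: continuous_along => m; exact: differentiable_continuous.
move=> s st; have ds := is_derive_along mu3 s st mu3_diff.
apply: is_derive_eq; rewrite d_mu3 Ik_skew /normsq_gradient flat_metricZr.
rewrite flat_metricDr !flat_metricZr Ik_isometry [flat_metric (Ik _) _]flat_metricC.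
rewrite Ij_Ik_orthogonal /field_normsq /=; ring.
Qed.

Lemma field_normsq_bounded K2 K3 : 0 <= K2 -> 0 <= K3 ->
  (forall x, `|flat_metric x (A (Ij x))| <= K2 * flat_metric x x) ->
  (forall x, `|flat_metric x (A (Ik x))| <= K3 * flat_metric x x) ->
  field_normsq t <= field_normsq 0 + 2 * (K2 + K3) * (`|mu2 (gam 0)| + `|mu3 (gam 0)|).
Proof.
move=> K2_ge0 K3_ge0 leK2 leK3; have field_normsq_ge0 s : 0 <= field_normsq s.
  exact: flat_metric_ge0.
have dA s : 0 < s < t -> is_derive s 1 (A \o gam) (A (grad (gam s))).
  by move=> st; apply: is_derive_linear; exact: gam_flow.
apply: (@growth_le_decay_bounded R (2 * c) (2 * (K2 + K3)) field_normsq
  (fun s => 4 * c * (mu2 (gam s) * flat_metric (A (gam s)) (A (Ij (A (gam s))))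
           + mu3 (gam s) * flat_metric (A (gam s)) (A (Ik (A (gam s))))))
  (mu2 \o gam) (mu3 \o gam) t);
  rewrite ?mulr_ge0 ?addr_ge0 //.
- exact: mu2_decays.
- exact: mu3_decays.
- have cA : continuous A by exact: mx_linear_continuous.
  by apply: (continuous_along _ (fun m => flat_metric (A m) (A m)));
    exact: flat_metric_continuous.
- move=> s st; have dAs := dA s st.
  have := is_derive_flat_metric _ _ _ _ _ _ _ dAs dAs.
  move=> dS; apply: (is_derive_eq dS).
  rewrite [flat_metric (A (grad _)) _]flat_metricC /= /normsq_gradient.
  rewrite !linearZ /= !linearD /=.
  rewrite !linearZ /= !flat_metricDr !flat_metricZr; ring.
- move=> s st; set X := A (gam s).
  have M0 := field_normsq_ge0 s; rewrite -/(field_normsq s) in M0.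
  have -> : 2 * (K2 + K3) * (2 * c * field_normsq s) *
      (`|(mu2 \o gam) s| + `|(mu3 \o gam) s|) =
    4 * c * ((K2 + K3) * field_normsq s * (`|mu2 (gam s)| + `|mu3 (gam s)|)).
    by rewrite /=; ring.
  apply: ler_wpM2l; first by rewrite mulr_ge0.
  have b2 : mu2 (gam s) * flat_metric X (A (Ij X)) <=
      `|mu2 (gam s)| * (K2 * field_normsq s).
    by rewrite (le_trans (ler_norm _)) // normrM ler_wpM2l // leK2.
  have b3 : mu3 (gam s) * flat_metric X (A (Ik X)) <=
      `|mu3 (gam s)| * (K3 * field_normsq s).
    by rewrite (le_trans (ler_norm _)) // normrM ler_wpM2l // leK3.
  apply: (le_trans (lerD b2 b3)).
  have p2 : 0 <= K3 * field_normsq s * `|mu2 (gam s)| by rewrite !mulr_ge0.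
  have p3 : 0 <= K2 * field_normsq s * `|mu3 (gam s)| by rewrite !mulr_ge0.
  lra.
Qed.

(** The velocity lies in the image of A, on which P A is the identity; so
    gam - P A gam has zero derivative. *)
Lemma transverse_part_constant (P : {linear V -> V}) :
  (forall x, P (A (A x)) = A x) ->
  gam t = gam 0 - P (A (gam 0)) + P (A (gam t)).
Proof.
move=> PA; apply/matrixP => r l.
pose y s := gam s r l - P (A (gam s)) r l.
have dy s : 0 < s < t -> is_derive s 1 y 0.
  move=> st; have dgs := gam_flow s st.
  have dg := is_derive_coord _ _ _ _ _ _ r l dgs.
  have dAg := is_derive_linear _ _ _ _ A _ _ _ dgs.
  have dPAg := is_derive_linear _ _ _ _ P _ _ _ dAg.
  have dP := is_derive_coord _ _ _ _ _ _ r l dPAg.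
  apply: is_derive_eq.
  have -> : grad (gam s) =
      A ((2 * c) *: (mu2 (gam s) *: Ij (gam s) + mu3 (gam s) *: Ik (gam s))).
    by rewrite linearZ /= linearD !linearZ /= A_Ij A_Ik.
  by rewrite PA subrr.
have cy : {within `[0, t], continuous y}.
  apply: (continuous_along _ (fun m => m r l - P (A m) r l)) => m.
  have cPA : continuous (P \o A) by exact: mx_linear_continuous.
  have c1 := @coord_continuous R n 4 r l m.
  have c2 := continuous_comp (cPA m) (@coord_continuous R n 4 r l _).
  exact: (cvgB c1 c2).
have : y t = y 0.
  apply/eqP; rewrite eq_le; apply/andP; split.
    exact: (@derive_le0_le R y (fun=> 0)).
  rewrite -lerN2; apply: (@derive_le0_le R (- y) (fun=> 0)) => //.
    by move=> s; apply: cvgN; exact: cy.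
  by move=> s /dy dys; apply: is_derive_eq; rewrite oppr0.
by rewrite /y !mxE => /eqP; lra.
Qed.

End Trajectory.

Lemma flow_closed_of_action :
  flow_closed (fun m => - (c * (mu2 m ^+ 2 + mu3 m ^+ 2))).
Proof.
have [K2 K2_ge0 leK2] := quadratic_form_bounded R n (A \o @Ij R n).
have [K3 K3_ge0 leK3] := quadratic_form_bounded R n (A \o @Ik R n).
(* A kills the kernel of A^2, as g(A x, A x) = - g(x, A (A x)). *)
have [x|P PA] := linear_factor R n 4 n 4 (A \o A) A.
  by move=> /= AAx; apply: flat_metric_eq0; rewrite A_skew AAx flat_metricr0 oppr0.
move=> p.
pose rho := flat_metric (A p) (A p) +
  2 * (K2 + K3) * (`|mu2 p| + `|mu3 p|).
(* rho bounds the squares of the entries of A gam, and sqrt rho <= 1 + rho. *)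
pose box := [set x : V | forall i j, `|x i j| <= 1 + rho].
exists ((fun x => p - P (A p) + P x) @` box).
  apply: continuous_compact; last exact: mx_box_compact.
  apply: continuous_subspaceT => x.
  have cP : continuous P by exact: mx_linear_continuous.
  apply: (@cvgD _ _ _ (nbhs x) _ (fun=> p - P (A p)) P); last exact: cP.
  exact: cvg_cst.
move=> T gam [gam0 gam_cont gam_grad] t t_ge0 tT.
have cont_t : {within `[0, t], continuous gam}.
  apply: continuous_subspaceW gam_cont => s /=; rewrite in_itv /= => /andP[s0 st].
  by split=> //; apply: le_lt_trans tT; rewrite lee_fin.
have flow_t s : 0 < s < t -> is_derive s 1 gam (grad (gam s)).
  move=> /andP[s0 st].
  have [|dg dgE] := gam_grad s s0.
    by apply: lt_trans tT; rewrite lte_fin.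
  split; first exact: dg.
  rewrite -derive1E; apply: flat_metric_inj => v.
  by rewrite dgE gradient_moment_normsq.
exists (A (gam t)); last first.
  by rewrite [RHS](transverse_part_constant gam t t_ge0 cont_t flow_t P PA) gam0.
move=> i j.
have := field_normsq_bounded gam t t_ge0 cont_t flow_t
  K2 K3 K2_ge0 K3_ge0 leK2 leK3.
rewrite gam0 -/rho => leM.
have M2 := le_trans (coord_sqr_le_flat_metric _ _ _ i j) leM.
have rho0 : 0 <= rho by apply: le_trans (sqr_ge0 _) M2.
have rho1 : 0 <= 1 + rho by rewrite addr_ge0.
rewrite -(@ler_pXn2r _ 2) ?nnegrE //.
rewrite real_normK ?num_real //; apply: (le_trans M2); nra.
Qed.

End GradientFlow.


(** * Flow-closedness *)

Theorem proposition1p6 (R : realType) (n : nat)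
    (act : R[i] -> quat_space R n -> quat_space R n)
    (hact : linear_hyperkahler_action act)
    (mu1 mu2 mu3 : quat_space R n -> R)
    (hmu : is_moment_map act mu1 mu2 mu3)
    (B : R -> R -> R) (hB : lie_inner_product B) :
  flow_closed (fun m => - dual_normsq B (complex_moment_map mu2 mu3 m)).
Proof.
have [A [AE A_skew A_Ij A_Ik]] := infinitesimal_action R n act hact.
have [_ [mu2_diff _ dmu2] [mu3_diff _ dmu3]] := hmu.
have -> : (fun m => - dual_normsq B (complex_moment_map mu2 mu3 m)) =
    (fun m => - ((B 1 1)^-1 * (mu2 m ^+ 2 + mu3 m ^+ 2))).
  apply/funext => m; rewrite /dual_normsq !sharpP // /sharp /=; congr (- _).
  ring.
apply: (flow_closed_of_action R n A) => //.
- by move=> m v; rewrite -[LHS]mulr1 dmu2 AE.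
- by move=> m v; rewrite -[LHS]mulr1 dmu3 AE.
- by rewrite invr_ge0 ltW // (lie_inner_pos hB) ?oner_neq0.
Qed.
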